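(* Let $g, b \in \mathbb{R}$ and let $v_i^l \le v_i^u$, $v_j^l \le v_j^u$, $c^l \le c^u$, $s^l \le s^u$ be real numbers. Let $B = [v_i^l,v_i^u]\times[v_j^l,v_j^u]\times[c^l,c^u]\times[s^l,s^u]$ and let $G = \{(z,v_i,v_j,c,s)\in\mathbb{R}^5 : (v_i,v_j,c,s)\in B,\ z = -g\,v_i v_j c - b\,v_i v_j s\}$. Then the strengthened QC relaxation captures the convex hull of the term $-g\,v_iv_jc - b\,v_iv_js$, i.e. the convex hull of $G$ equals the set of all $(z,v_i,v_j,c,s)\in\mathbb{R}^5$ for which there exist $z_c,z_s\in\mathbb{R}$ and $\lambda^c,\lambda^s\in\mathbb{R}^8$ such that (i) $(z_c,v_i,v_j,c,\lambda^c)$ satisfies the extreme-point relaxation of the trilinear term $v_iv_jc$ over $[v_i^l,v_i^u]\times[v_j^l,v_j^u]\times[c^l,c^u]$; (ii) $(z_s,v_i,v_j,s,\lambda^s)$ satisfies the extreme-point relaxation of the trilinear term $v_iv_js$ over $[v_i^l,v_i^u]\times[v_j^l,v_j^u]\times[s^l,s^u]$; (iii) $z = -g\,z_c - b\,z_s$; (iv) the linking constraint $$(\lambda^c_1+\lambda^c_2-\lambda^s_1-\lambda^s_2)v_i^lv_j^l + (\lambda^c_3+\lambda^c_4-\lambda^s_3-\lambda^s_4)v_i^lv_j^u + (\lambda^c_5+\lambda^c_6-\lambda^s_5-\lambda^s_6)v_i^uv_j^l + (\lambda^c_7+\lambda^c_8-\lambda^s_7-\lambda^s_8)v_i^uv_j^u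 = 0$$ holds.
   Context: Extreme-point relaxation of a trilinear term: given bounds $x_m^l\le x_m\le x_m^u$ for $m=1,2,3$, list the eight vertices of the box in dictionary order: $\xi_1=(x_1^l,x_2^l,x_3^l)$, $\xi_2=(x_1^l,x_2^l,x_3^u)$, $\xi_3=(x_1^l,x_2^u,x_3^l)$, $\xi_4=(x_1^l,x_2^u,x_3^u)$, $\xi_5=(x_1^u,x_2^l,x_3^l)$, $\xi_6=(x_1^u,x_2^l,x_3^u)$, $\xi_7=(x_1^u,x_2^u,x_3^l)$, $\xi_8=(x_1^u,x_2^u,x_3^u)$, and let $\xi_k^m$ be the $m$-th coordinate of $\xi_k$. A tuple $(y,x_1,x_2,x_3,\lambda)$ with $\lambda\in\mathbb{R}^8$ satisfies the extreme-point relaxation of $x_1x_2x_3$ if $y=\sum_{k=1}^8\lambda_k\,\xi_k^1\xi_k^2\xi_k^3$, $x_m=\sum_{k=1}^8\lambda_k\xi_k^m$ for $m=1,2,3$, $\sum_{k=1}^8\lambda_k=1$, and $\lambda_k\ge 0$ for all $k$. In the application, for a branch $(i,j)$ of a power network with admittance $g+\mathbf{i}b$, $v_i,v_j$ are voltage magnitudes and $c,s$ are the lifted variables standing for $\cos\theta_{ij}$ and $\sin\theta_{ij}$, where $\theta_{ij}$ is the phase angle difference. The part of the strengthened QC relaxation modelling the term consists of the constraints (i)-(iv). *)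

(* Defs.v *)
From mathcomp Require Import all_boot all_order all_algebra.
From mathcomp Require Import boolp classical_sets reals convex.

Set Implicit Arguments.
Unset Strict Implicit.
Unset Printing Implicit Defensive.

Import Order.TTheory GRing.Theory Num.Theory.

Local Open Scope classical_set_scope.
Local Open Scope ring_scope.

Definition convex_hull (R : numDomainType) (M : lmodType R) (A : set M) :
  set M := smallest (@convex_set R M) A.

Definition row_of_tuple (R : Type) (n : nat) (t : n.-tuple R) : 'rV[R]_n :=
  \row_(i < n) tnth t i.

(* Row k (counted from 0) is the vertex xi_(k+1) in dictionary order. *)
Definition box_vertices (R : Type) (x1l x1u x2l x2u x3l x3u : R) :
  'M[R]_(8, 3) :=
  \matrix_(k < 8, m < 3) tnth (tnth
    [tuple [tuple x1l; x2l; x3l];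
           [tuple x1l; x2l; x3u];
           [tuple x1l; x2u; x3l];
           [tuple x1l; x2u; x3u];
           [tuple x1u; x2l; x3l];
           [tuple x1u; x2l; x3u];
           [tuple x1u; x2u; x3l];
           [tuple x1u; x2u; x3u]] k) m.

Definition extreme_point_relaxation (R : realType)
    (x1l x1u x2l x2u x3l x3u : R) (y x1 x2 x3 : R) (lam : 'rV[R]_8) : Prop :=
  let xi := box_vertices x1l x1u x2l x2u x3l x3u in
  [/\ y = \sum_(k < 8) lam 0 k * \prod_(m < 3) xi k m,
      forall m : 'I_3,
        tnth [tuple x1; x2; x3] m = \sum_(k < 8) lam 0 k * xi k m,
      \sum_(k < 8) lam 0 k = 1
    & forall k : 'I_8, 0 <= lam 0 k].

(* [C k] and [S k] are the k-th multipliers counted from 1, k = 1, ..., 8. *)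
Definition linking_constraint (R : realType) (vil viu vjl vju : R)
    (lamc lams : 'rV[R]_8) : Prop :=
  let C k := lamc 0 (inord k.-1) in
  let S k := lams 0 (inord k.-1) in
  (C 1%N + C 2%N - S 1%N - S 2%N) * (vil * vjl)
  + (C 3%N + C 4%N - S 3%N - S 4%N) * (vil * vju)
  + (C 5%N + C 6%N - S 5%N - S 6%N) * (viu * vjl)
  + (C 7%N + C 8%N - S 7%N - S 8%N) * (viu * vju) = 0.

Definition term_graph (R : realType)
    (g b vil viu vjl vju cl cu sl su : R) : set 'rV[R]_5 :=
  [set p | exists z vi vj c s : R,
    [/\ p = row_of_tuple [tuple z; vi; vj; c; s],
        vil <= vi <= viu /\ vjl <= vj <= vju,
        cl <= c <= cu /\ sl <= s <= su
      & z = - g * vi * vj * c - b * vi * vj * s]].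

Definition strengthened_QC (R : realType)
    (g b vil viu vjl vju cl cu sl su : R) : set 'rV[R]_5 :=
  [set p | exists z vi vj c s : R,
    p = row_of_tuple [tuple z; vi; vj; c; s] /\
    exists (zc zs : R) (lamc lams : 'rV[R]_8),
    [/\ extreme_point_relaxation vil viu vjl vju cl cu zc vi vj c lamc,
        extreme_point_relaxation vil viu vjl vju sl su zs vi vj s lams,
        z = - g * zc - b * zs
      & linking_constraint vil viu vjl vju lamc lams]].

(* Main.v *)
(** A pair of multipliers puts masses [p] and [q] on the four vertices of the
    [(v_i, v_j)]-rectangle, obtained by summing out the [c]- resp. [s]-endpoint.
    The relaxations and the linking constraint say that [p] and [q] have the same
    moments [1], [v_i], [v_j], [v_i v_j], hence coincide.  Since the term is affine
    in [(c, s)] at fixed [(v_i, v_j)], replacing [c] and [s] by their conditional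
    means at each vertex writes the point as a convex combination of four graph
    points.  Conversely the relaxation is convex, and product weights show that it
    contains the graph. *)
Require Import Defs.
From mathcomp Require Import all_boot all_order all_algebra.
From mathcomp Require Import boolp classical_sets reals convex.
From mathcomp Require Import interval_inference ring lra.

Local Open Scope ring_scope.

Import Order.TTheory GRing.Theory Num.Theory.

(** * Finite convex combinations *)

(** Asking for membership only at nonzero weights leaves [f i] free where it is later defined by a
    division by [w i]. *)
Lemma convex_set_sum {R : numFieldType} {M : lmodType R} (A : set M)
    (I : finType) (w : I -> R) (f : I -> M) :
  @convex_set R M A -> (forall i, 0 <= w i) -> \sum_i w i = 1 ->
  (forall i, w i != 0 -> A (f i)) -> A (\sum_i w i *: f i).
Proof.
move=> cA w0 w1 fA.
(* Partial weights need not sum to 1, so the induction runs over normalised partial combinations. A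
   new point enters with coefficient [w i / (w i + W)]. *)
suff H (s : seq I) : \sum_(i <- s) w i != 0 ->
    A ((\sum_(i <- s) w i)^-1 *: \sum_(i <- s) w i *: f i).
  by have := H (index_enum I); rewrite w1 invr1 scale1r; apply; rewrite oner_neq0.
elim: s => [|i s IH]; first by rewrite big_nil eqxx.
rewrite !big_cons; set W := \sum_(j <- s) w j; set F := \sum_(j <- s) _.
have W0 : 0 <= W by apply: sumr_ge0.
have [Wz|Wn0] := eqVneq W 0.
  have -> : F = 0.
    rewrite /F big_seq big1// => j js.
    have /allP/(_ j js)/= : all (fun j => w j == 0) s.
      by have /eqP := Wz; rewrite /W psumr_eq0.
    by move=> /eqP ->; rewrite scale0r.
  rewrite Wz !addr0 => wi; rewrite scalerA mulVf// scale1r; exact: fA.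
have [wiz|win0] := eqVneq (w i) 0.
  by rewrite wiz add0r scale0r add0r => _; exact: IH.
move=> Sn0; have S0 : 0 <= w i + W by rewrite addr_ge0.
have t01 : Itv.spec (@Itv.num_sem R) (Itv.Real `[0%Z, 1%Z]) (w i / (w i + W)).
  apply/and3P; split=> /=.
  - by apply: ger0_real; rewrite divr_ge0.
  - by rewrite bnd_simp divr_ge0.
  - by rewrite bnd_simp ler_pdivrMr ?mul1r ?lerDl// lt_neqAle eq_sym Sn0.
have := cA (f i) (W^-1 *: F) (Itv.mk t01); rewrite !inE.
move=> /(_ (fA _ win0) (IH Wn0)).
rewrite [X in A X -> _](_ : _ = (w i + W)^-1 *: (w i *: f i + F))//.
rewrite /conv/= scalerDr !scalerA; congr (_ *: _ + _ *: _).
  by rewrite mulrC.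
rewrite /unstable.onem; field; exact/andP.
Qed.

(** * Coordinates and convexity of the relaxation *)

(** The formula for [y] is grouped by the vertices of the [(x1, x2)]-rectangle, so that the third
    endpoint can be averaged out at each of them. *)
Lemma extreme_point_relaxationE (R : realType)
    (x1l x1u x2l x2u x3l x3u y x1 x2 x3 : R) (lam : 'rV[R]_8) :
  let l k := lam 0 (inord k) in
  extreme_point_relaxation x1l x1u x2l x2u x3l x3u y x1 x2 x3 lam <->
  [/\ y = (l 0%N * x3l + l 1%N * x3u) * (x1l * x2l)
          + (l 2%N * x3l + l 3%N * x3u) * (x1l * x2u)
          + (l 4%N * x3l + l 5%N * x3u) * (x1u * x2l)
          + (l 6%N * x3l + l 7%N * x3u) * (x1u * x2u),
      [/\ x1 = (l 0%N + l 1%N + l 2%N + l 3%N) * x1l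
          + (l 4%N + l 5%N + l 6%N + l 7%N) * x1u,
      x2 = (l 0%N + l 1%N + l 4%N + l 5%N) * x2l
          + (l 2%N + l 3%N + l 6%N + l 7%N) * x2u &
      x3 = (l 0%N + l 2%N + l 4%N + l 6%N) * x3l
          + (l 1%N + l 3%N + l 5%N + l 7%N) * x3u],
      l 0%N + l 1%N + l 2%N + l 3%N + l 4%N + l 5%N + l 6%N + l 7%N = 1
    & forall k : 'I_8, 0 <= lam 0 k].
Proof.
move=> l.
have sumE (F : 'I_8 -> R) : \sum_(k < 8) lam 0 k * F k =
    l 0%N * F (inord 0) + l 1%N * F (inord 1) + l 2%N * F (inord 2)
    + l 3%N * F (inord 3) + l 4%N * F (inord 4) + l 5%N * F (inord 5)
    + l 6%N * F (inord 6) + l 7%N * F (inord 7).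
  rewrite (eq_bigr (fun k : 'I_8 => l k * F (inord k))); last first.
    by move=> k _; rewrite /l !inord_val.
  rewrite -(big_mkord xpredT (fun k => l k * F (inord k))).
  by rewrite !big_nat_recr//= big_nil add0r.
have sum1E : \sum_(k < 8) lam 0 k =
    l 0%N + l 1%N + l 2%N + l 3%N + l 4%N + l 5%N + l 6%N + l 7%N.
  rewrite -[LHS](eq_bigr _ (fun k _ => mulr1 (lam 0 k))) (sumE (fun=> 1)).
  by rewrite !mulr1.
(* In dictionary order the binary digits of [k], most significant first, select the endpoints of the
   three coordinates. *)
have xiE (k : 'I_8) (m : 'I_3) :
    box_vertices x1l x1u x2l x2u x3l x3u k m =
    [:: if (k < 4)%N then x1l else x1u;
        if odd k./2 then x2u else x2l; if odd k then x3u else x3l]`_m.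
  rewrite mxE (tnth_nth 0) (tnth_nth [tuple 0; 0; 0]).
  by case: k m => [[|[|[|[|[|[|[|[|//]]]]]]]] ?] [[|[|[|//]]] ?].
have coordE (m : 'I_3) : tnth [tuple x1; x2; x3] m = [:: x1; x2; x3]`_m.
  by rewrite (tnth_nth 0).
rewrite /extreme_point_relaxation sum1E !sumE.
split=> [[-> x123 l1 l0]|[-> [x1E x2E x3E] l1 l0]]; split=> //.
- rewrite !big_ord_recr !big_ord0/= !xiE/= !inordK//=; ring.
- have xE (m : 'I_3) := etrans (esym (coordE m)) (etrans (x123 m) (sumE _)).
  split.
  + by have := xE (inord 0); rewrite !xiE !inordK//= => ->; ring.
  + by have := xE (inord 1); rewrite !xiE !inordK//= => ->; ring.
  + by have := xE (inord 2); rewrite !xiE !inordK//= => ->; ring.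
- rewrite !big_ord_recr !big_ord0/= !xiE/= !inordK//=; ring.
- move=> m; rewrite coordE sumE !xiE !inordK//.
  by case: m => [[|[|[|//]]] ?]/=; rewrite ?x1E ?x2E ?x3E; ring.
Qed.

(** For fixed bounds, every condition is a linear equation or inequality in the point and its
    multipliers jointly. *)
Lemma extreme_point_relaxation_conv (R : realType)
    (x1l x1u x2l x2u x3l x3u t y x1 x2 x3 y' x1' x2' x3' : R)
    (lam lam' : 'rV[R]_8) :
  0 <= t <= 1 ->
  extreme_point_relaxation x1l x1u x2l x2u x3l x3u y x1 x2 x3 lam ->
  extreme_point_relaxation x1l x1u x2l x2u x3l x3u y' x1' x2' x3' lam' ->
  extreme_point_relaxation x1l x1u x2l x2u x3l x3u
    (t * y + (1 - t) * y') (t * x1 + (1 - t) * x1') (t * x2 + (1 - t) * x2')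
    (t * x3 + (1 - t) * x3') (t *: lam + (1 - t) *: lam').
Proof.
move=> /andP[t0 t1] /extreme_point_relaxationE[-> [-> -> ->] l1 l0].
move=> /extreme_point_relaxationE[-> [-> -> ->] l1' l0'].
apply/extreme_point_relaxationE; rewrite !mxE; split; [ring|split; ring| |].
  transitivity (t * 1 + (1 - t) * 1); last by ring.
  rewrite -[X in _ = t * X + _]l1 -[X in _ = _ + (1 - t) * X]l1'; ring.
by move=> k; rewrite !mxE addr_ge0// mulr_ge0// subr_ge0.
Qed.

Lemma convex_strengthened_QC (R : realType)
    (g b vil viu vjl vju cl cu sl su : R) :
  @convex_set R _ (strengthened_QC g b vil viu vjl vju cl cu sl su).
Proof.
move=> p q k; rewrite !inE.
move=> [z [vi [vj [c [s [-> [zc [zs [lc [ls [hc hs hz hl]]]]]]]]]]].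
move=> [z' [vi' [vj' [c' [s' [-> [zc' [zs' [lc' [ls' [hc' hs' hz' hl']]]]]]]]]]].
have : 0 <= k%:num <= 1 by rewrite ge0 le1.
set t := k%:num => t01.
exists (t * z + (1 - t) * z'), (t * vi + (1 - t) * vi'),
  (t * vj + (1 - t) * vj'), (t * c + (1 - t) * c'), (t * s + (1 - t) * s').
split.
  apply/rowP => i; rewrite !mxE !(tnth_nth 0).
  by case: i => [[|[|[|[|[|//]]]]] ?].
exists (t * zc + (1 - t) * zc'), (t * zs + (1 - t) * zs'),
  (t *: lc + (1 - t) *: lc'), (t *: ls + (1 - t) *: ls').
split; [exact: extreme_point_relaxation_conv..| |].
  by rewrite hz hz'; ring.
move: hl hl'; rewrite /linking_constraint !mxE/= => hl hl'.
transitivity (t * 0 + (1 - t) * 0); last by ring.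
rewrite -[X in _ = t * X + _]hl -[X in _ = _ + (1 - t) * X]hl'; ring.
Qed.

(** * Inclusion of the graph in the relaxation *)

Lemma itv_convP {R : realFieldType} {l u x : R} : l <= x <= u ->
  exists t, [/\ 0 <= t, 0 <= 1 - t & x = (1 - t) * l + t * u].
Proof.
move=> /andP[lx xu]; have [lu|] := ltP l u; last first.
  (* The interval is a single point here, so any parameter in [[0, 1]] would do. *)
  by move=> ul; exists 0; split; lra.
exists ((x - l) / (u - l)); split.
- by rewrite divr_ge0 ?subr_ge0// ltW.
- by rewrite subr_ge0 ler_pdivrMr ?subr_gt0// mul1r; lra.
- by field; rewrite subr_eq0 gt_eqF.
Qed.

(* The multipliers of a point of the box are the products of the barycentric
   coordinates of its entries. *)
Definition vertex_weights {R : pzRingType} (t1 t2 t3 : R) : 'rV[R]_8 :=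
  row_of_tuple
    [tuple (1 - t1) * (1 - t2) * (1 - t3); (1 - t1) * (1 - t2) * t3;
           (1 - t1) * t2 * (1 - t3); (1 - t1) * t2 * t3;
           t1 * (1 - t2) * (1 - t3); t1 * (1 - t2) * t3;
           t1 * t2 * (1 - t3); t1 * t2 * t3].

(** Under product weights, the mean of a product of coordinates is the product of their means. *)
Lemma extreme_point_relaxation_graph (R : realType)
    (x1l x1u x2l x2u x3l x3u t1 t2 t3 : R) :
  0 <= t1 -> 0 <= 1 - t1 -> 0 <= t2 -> 0 <= 1 - t2 -> 0 <= t3 -> 0 <= 1 - t3 ->
  let x1 := (1 - t1) * x1l + t1 * x1u in
  let x2 := (1 - t2) * x2l + t2 * x2u in
  let x3 := (1 - t3) * x3l + t3 * x3u in
  extreme_point_relaxation x1l x1u x2l x2u x3l x3u (x1 * x2 * x3) x1 x2 x3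
    (vertex_weights t1 t2 t3).
Proof.
move=> ? ? ? ? ? ? x1 x2 x3; rewrite /x1 /x2 /x3.
apply/extreme_point_relaxationE; rewrite !mxE !(tnth_nth 0) !inordK//=.
split; [ring|split; ring|ring|].
move=> k; rewrite mxE (tnth_nth 0).
by case: k => [[|[|[|[|[|[|[|[|//]]]]]]]] ?]/=; rewrite !mulr_ge0.
Qed.

Lemma term_graph_sub_QC (R : realType) (g b vil viu vjl vju cl cu sl su : R) :
  (term_graph g b vil viu vjl vju cl cu sl su `<=`
   strengthened_QC g b vil viu vjl vju cl cu sl su)%classic.
Proof.
move=> p [z [vi [vj [c [s [-> [bi bj] [bc bs] ->]]]]]].
have [t1 [? ? ei]] := itv_convP bi; have [t2 [? ? ej]] := itv_convP bj.
have [t3 [? ? ec]] := itv_convP bc; have [t4 [? ? es]] := itv_convP bs.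
exists (- g * vi * vj * c - b * vi * vj * s), vi, vj, c, s; split=> //.
(* Both families share [t1] and [t2]: summing out [t3] or [t4] leaves the same vertex masses, so
   every difference in the linking constraint vanishes. *)
exists (vi * vj * c), (vi * vj * s), (vertex_weights t1 t2 t3),
  (vertex_weights t1 t2 t4).
split.
- by rewrite ei ej ec; exact: extreme_point_relaxation_graph.
- by rewrite ei ej es; exact: extreme_point_relaxation_graph.
- ring.
- rewrite /linking_constraint !mxE !(tnth_nth 0) !inordK//=; ring.
Qed.

(** * Convex combinations of graph points *)

(** [ga i] and [si i] are values of [c] and [s] scaled by the mass [w i]. Dividing by a nonzero mass
    gives a graph point; at zero mass the bounds force both to vanish. *)
Lemma term_graph_hull_sum (R : realType) (g b vil viu vjl vju cl cu sl su : R)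
    (I : finType) (w x y ga si : I -> R) (z vi vj c s : R) :
  (forall i, 0 <= w i) -> \sum_i w i = 1 ->
  (forall i, vil <= x i <= viu) -> (forall i, vjl <= y i <= vju) ->
  (forall i, w i * cl <= ga i <= w i * cu) ->
  (forall i, w i * sl <= si i <= w i * su) ->
  z = \sum_i x i * y i * (- g * ga i - b * si i) ->
  vi = \sum_i w i * x i -> vj = \sum_i w i * y i ->
  c = \sum_i ga i -> s = \sum_i si i ->
  convex_hull (term_graph g b vil viu vjl vju cl cu sl su)
    (row_of_tuple [tuple z; vi; vj; c; s]).
Proof.
move=> w0 w1 bx byy bga bsi -> -> -> -> ->.
have wK (f : I -> R) l u i : (forall i, w i * l <= f i <= w i * u) ->
    w i * (f i / w i) = f i.
  move=> /(_ i) fb; have [wi0|wi0] := eqVneq (w i) 0; last by field.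
  by move: fb; rewrite wi0 !mul0r => /le_anti ->.
have wdiv (f : I -> R) l u i : (forall i, w i * l <= f i <= w i * u) ->
    w i != 0 -> l <= f i / w i <= u.
  move=> /(_ i) /andP[lf fu] wi0.
  have wi : 0 < w i by rewrite lt_neqAle eq_sym wi0 w0.
  by rewrite ler_pdivlMr// ler_pdivrMr// mulrC lf mulrC.
pose f i := row_of_tuple [tuple x i * y i * (- g * (ga i / w i) - b * (si i / w i));
  x i; y i; ga i / w i; si i / w i].
have -> : row_of_tuple [tuple \sum_i x i * y i * (- g * ga i - b * si i);
    \sum_i w i * x i; \sum_i w i * y i; \sum_i ga i; \sum_i si i]
    = \sum_i w i *: f i.
  apply/rowP => k; rewrite summxE mxE (tnth_nth 0).
  under [RHS]eq_bigr do rewrite !mxE (tnth_nth 0).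
  case: k => [[|[|[|[|[|//]]]]] ?]/=; apply: eq_bigr => i _ //.
  - by rewrite -{1}(wK _ _ _ i bga) -{1}(wK _ _ _ i bsi); ring.
  - by rewrite (wK _ _ _ i bga).
  - by rewrite (wK _ _ _ i bsi).
(* The hull is convex, being the intersection of all convex sets containing the graph. *)
apply: convex_set_sum => // [p q k|i wi0].
  rewrite !inE => hp hq A [cA GA].
  by have := cA p q k; rewrite !inE; apply; [exact: hp|exact: hq].
apply: sub_gen_smallest; exists (x i * y i * (- g * (ga i / w i) - b * (si i / w i))),
  (x i), (y i), (ga i / w i), (si i / w i); split=> //; [|ring].
by split; [exact: wdiv bga wi0|exact: wdiv bsi wi0].
Qed.

(** * Vertex masses from moments *)

(* When the box is degenerate in a coordinate, both endpoints are represented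
   by [false]. *)
Definition endpoint_repr {R : eqType} (x : bool -> R) (a : bool) : bool :=
  (x true != x false) && a.

Lemma endpoint_reprK {R : eqType} (x : bool -> R) a : x (endpoint_repr x a) = x a.
Proof. by case: a; rewrite /endpoint_repr ?andbF// andbT; case: eqVneq. Qed.

(** Two distinct endpoints are separated by linear interpolation; if they coincide, the
    representative is always [false] and the indicator is constant. *)
Lemma endpoint_indicator_affine {R : fieldType} (x : bool -> R) (a : bool) :
  exists u v, forall a', (endpoint_repr x a' == a)%:R = u + v * x a'.
Proof.
rewrite /endpoint_repr; have [_|x10] /= := eqVneq (x true) (x false).
  by exists (~~ a)%:R, 0 => a'; rewrite mul0r addr0; case: a.
have xD : x a - x (~~ a) != 0 by rewrite subr_eq0; case: a; rewrite // eq_sym.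
exists (- x (~~ a) / (x a - x (~~ a))), (x a - x (~~ a))^-1 => a'.
have -> : x a' = if a' == a then x a else x (~~ a) by case: a' a {xD} => [] [].
by case: (a' == a) => /=; field.
Qed.

(* Indicators of distinct vertices are products of two affine functions, so the
   moments 1, x, y, xy determine the mass at each of them. *)
Lemma vertex_mass_eq0 {R : fieldType} (x y : bool -> R) (d : bool * bool -> R)
    (k : bool * bool) :
  \sum_i d i = 0 -> \sum_i d i * x i.1 = 0 -> \sum_i d i * y i.2 = 0 ->
  \sum_i d i * (x i.1 * y i.2) = 0 ->
  \sum_(i | (endpoint_repr x i.1, endpoint_repr y i.2) == k) d i = 0.
Proof.
move=> d1 dx dy dxy; rewrite big_mkcond/=.
have [u [v uvE]] := endpoint_indicator_affine x k.1.
have [u' [v' uvE']] := endpoint_indicator_affine y k.2.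
transitivity (\sum_i (u * u' * d i + v * u' * (d i * x i.1)
    + u * v' * (d i * y i.2) + v * v' * (d i * (x i.1 * y i.2)))).
  apply: eq_bigr => i _.
  transitivity (d i * ((u + v * x i.1) * (u' + v' * y i.2))); last by ring.
  rewrite -uvE -uvE' -natrM mulnb -xpair_eqE -surjective_pairing.
  by case: ifP => _; rewrite ?mulr1 ?mulr0.
by rewrite !big_split/= -!mulr_sumr d1 dx dy dxy !mulr0 !addr0.
Qed.

(* The two vertex distributions [p] and [q] need only have equal moments; they
   become equal once coinciding vertices are merged. *)
Lemma term_graph_hull_vertices (R : realType)
    (g b vil viu vjl vju cl cu sl su : R) (x y : bool -> R)
    (p q ga si : bool * bool -> R) (z vi vj c s : R) :
  (forall i, 0 <= p i) -> \sum_i p i = 1 -> \sum_i q i = 1 ->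
  (forall a, vil <= x a <= viu) -> (forall a, vjl <= y a <= vju) ->
  (forall i, p i * cl <= ga i <= p i * cu) ->
  (forall i, q i * sl <= si i <= q i * su) ->
  \sum_i q i * x i.1 = \sum_i p i * x i.1 ->
  \sum_i q i * y i.2 = \sum_i p i * y i.2 ->
  \sum_i q i * (x i.1 * y i.2) = \sum_i p i * (x i.1 * y i.2) ->
  z = \sum_i x i.1 * y i.2 * (- g * ga i - b * si i) ->
  vi = \sum_i p i * x i.1 -> vj = \sum_i p i * y i.2 ->
  c = \sum_i ga i -> s = \sum_i si i ->
  convex_hull (term_graph g b vil viu vjl vju cl cu sl su)
    (row_of_tuple [tuple z; vi; vj; c; s]).
Proof.
move=> p0 p1 q1 xB yB gaB siB ex ey exy -> -> -> -> ->.
pose r (i : bool * bool) := (endpoint_repr x i.1, endpoint_repr y i.2).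
(* Pushforward along [r]: values at coinciding vertices are added up at their representative. *)
pose merge (f : bool * bool -> R) k := \sum_(i | r i == k) f i.
have mergeE f : \sum_i f i = \sum_k merge f k.
  by rewrite (partition_big r xpredT).
have merge_le f h k l : (forall i, f i * l <= h i) -> merge f k * l <= merge h k.
  by move=> fh; rewrite mulr_suml; apply: ler_sum.
have merge_ge f h k u : (forall i, h i <= f i * u) -> merge h k <= merge f k * u.
  by move=> fh; rewrite mulr_suml; apply: ler_sum.
have mergeM f h k : (forall i, h (r i) = h i) ->
    merge (fun i => f i * h i) k = merge f k * h k.
  move=> hr; rewrite mulr_suml; apply: eq_bigr => i /eqP <-.
  by rewrite hr.
have merge_pq k : merge q k = merge p k.
  apply/eqP; rewrite -subr_eq0 -sumrB; apply/eqP.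
  apply: vertex_mass_eq0; first by rewrite sumrB p1 q1 subrr.
  - by under eq_bigr do rewrite mulrBl; rewrite sumrB ex subrr.
  - by under eq_bigr do rewrite mulrBl; rewrite sumrB ey subrr.
  - by under eq_bigr do rewrite mulrBl; rewrite sumrB exy subrr.
apply: (@term_graph_hull_sum _ _ _ _ _ _ _ _ _ _ _ _ (merge p)
  (fun i => x i.1) (fun i => y i.2) (merge ga) (merge si)); rewrite -?mergeE//.
- by move=> k; apply: sumr_ge0.
- move=> k; apply/andP; split; [apply: merge_le|apply: merge_ge] => i;
    by have /andP[] := gaB i.
(* The bounds on [si] involve [q]; equality of the merged masses lets one weight serve both [c] and
   [s]. *)
- move=> k; rewrite -merge_pq; apply/andP.
  split; [apply: merge_le|apply: merge_ge] => i; by have /andP[] := siB i.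
- rewrite mergeE; apply: eq_bigr => k _.
  transitivity (merge (fun i => (- g * ga i - b * si i) * (x i.1 * y i.2)) k).
    by apply: eq_bigr => i _; rewrite mulrC.
  rewrite (mergeM _ (fun i => x i.1 * y i.2)); last first.
    by move=> i; rewrite /= !endpoint_reprK.
  by rewrite mulrC /merge sumrB !mulr_sumr.
- rewrite mergeE; apply: eq_bigr => k _.
  by rewrite (mergeM _ (fun i => x i.1))// => i; rewrite endpoint_reprK.
- rewrite mergeE; apply: eq_bigr => k _.
  by rewrite (mergeM _ (fun i => y i.2))// => i; rewrite endpoint_reprK.
Qed.

(** * Inclusion of the relaxation in the hull *)

Lemma QC_sub_hull (R : realType) (g b vil viu vjl vju cl cu sl su : R) :
  vil <= viu -> vjl <= vju -> cl <= cu -> sl <= su ->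
  (strengthened_QC g b vil viu vjl vju cl cu sl su `<=`
   convex_hull (term_graph g b vil viu vjl vju cl cu sl su))%classic.
Proof.
move=> hvi hvj hc hs p.
move=> [z [vi [vj [c [s [-> [zc [zs [lc [ls [hlc hls -> link]]]]]]]]]]].
move: hlc hls link => /extreme_point_relaxationE + /extreme_point_relaxationE.
rewrite /linking_constraint/=.
move=> [-> [ei ej ->] sumc lc0] [-> [ei' ej' ->] sums ls0] link.
(* A rectangle vertex is a pair of booleans, [true] for the upper endpoint. It gives the two leading
   binary digits of the index; the last digit separates [low] from [up]. *)
pose low (l : 'rV[R]_8) (i : bool * bool) := l 0 (inord (4 * i.1 + 2 * i.2)).
pose up (l : 'rV[R]_8) (i : bool * bool) := l 0 (inord (4 * i.1 + 2 * i.2).+1).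
pose mean l i (m n : R) := low l i * m + up l i * n.
have btw (l : 'rV[R]_8) i (m n : R) : (forall k, 0 <= l 0 k) -> m <= n ->
    (low l i + up l i) * m <= mean l i m n <= (low l i + up l i) * n.
  move=> l0 mn; rewrite /mean !mulrDl.
  by rewrite lerD2l lerD2r !ler_wpM2l ?l0.
have sumE (F : bool * bool -> R) : \sum_i F i =
    F (false, false) + F (false, true) + F (true, false) + F (true, true).
  rewrite (eq_bigr (fun i => F (i.1, i.2))); last by case.
  by rewrite -(pair_bigA _ (fun a b => F (a, b)))/= !big_bool/=; ring.
apply: (@term_graph_hull_vertices _ _ _ _ _ _ _ _ _ _ _
  (fun a => if a then viu else vil) (fun a => if a then vju else vjl)
  (fun i => low lc i + up lc i) (fun i => low ls i + up ls i)
  (fun i => mean lc i cl cu) (fun i => mean ls i sl su));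
  rewrite ?sumE /mean /low /up/=.
- by move=> i; rewrite addr_ge0.
- by rewrite -[RHS]sumc !addrA.
- by rewrite -[RHS]sums !addrA.
- by case; rewrite lexx hvi.
- by case; rewrite lexx hvj.
- by move=> i; exact: btw.
- by move=> i; exact: btw.
- by transitivity vi; [rewrite ei'|rewrite ei]; ring.
- by transitivity vj; [rewrite ej'|rewrite ej]; ring.
(* The linking constraint is exactly the equality of the [v_i v_j] moments, with the opposite
   sign. *)
- by apply/eqP; rewrite -subr_eq0 -oppr_eq0 -link; apply/eqP; ring.
- ring.
- rewrite ei; ring.
- rewrite ej; ring.
- ring.
- ring.
Qed.

Theorem theorem1 (R : realType) (g b vil viu vjl vju cl cu sl su : R)
    (hvi : vil <= viu) (hvj : vjl <= vju) (hc : cl <= cu) (hs : sl <= su) :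
  convex_hull (term_graph g b vil viu vjl vju cl cu sl su) =
  strengthened_QC g b vil viu vjl vju cl cu sl su.
Proof.
apply/seteqP; split; last exact: QC_sub_hull.
apply: smallest_sub; first exact: convex_strengthened_QC.
exact: term_graph_sub_QC.
Qed.
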